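(* Let $H$ be a hypergraph with no isolated vertices, and let $p\in(0,1)$ be such that every edge in $H$ is flammable with respect to $p$. Then $$\min\{\lceil p|e|\rceil \mid e\in E(H)\}\leq b_{L,p}(H)< b_p(H)\leq 1+\sum_{e\in E(H)}\lceil p|e|\rceil.$$
   Context: A hypergraph $H=(V(H),E(H))$ has a finite nonempty vertex set and a finite collection $E(H)$ of subsets of $V(H)$ called edges (parallel edges allowed); a vertex is isolated if it lies in no edge. An edge $e$ is non-flammable with respect to $p$ if $\lceil p|e|\rceil=|e|$, and flammable otherwise. For a proportion $p\in(0,1)$, the proportion-based propagation rule is: if at the end of a round at least $\lceil p|e|\rceil$ vertices of an edge $e$ are on fire, then in the next round all vertices of $e$ catch fire; burned vertices stay burned. Burning game: let $F_0=\emptyset$ and $F_r$ be the set of burned vertices at the end of round $r$. In each round $r\geq 1$, simultaneously, vertices catch fire by propagation from $F_{r-1}$ (no propagation in round 1), and a player chooses a vertex $u_r\notin F_{r-1}$ (a source) and sets it on fire. A burning sequence is a sequence $(u_1,\ldots,u_k)$ of such sources after which every vertex is on fire at the end of round $k$; $b_p(H)$ is the minimum length of a burning sequence. Lazy game: $S\subseteq V(H)$ is a lazy burning set if, setting all of $S$ on fire at once and then repeatedly applying the propagation rule, every vertex eventually catches fire; $b_{L,p}(H)$ is the minimum size of a lazy burning set. *)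

(* Defs.v *)
From HB Require Import structures.
From mathcomp Require Import all_boot all_order all_algebra.
From mathcomp Require Import boolp reals.

Set Implicit Arguments.
Unset Strict Implicit.
Unset Printing Implicit Defensive.

Import Order.TTheory GRing.Theory Num.Theory.

Local Open Scope nat_scope.

(* Edges are labels carrying a set of vertices, so that distinct labels may    *)
(* carry the same set (parallel edges); empty edges are allowed.               *)
Record hypergraph := Hypergraph {
  vertex : finType;
  edge : finType;
  inc : edge -> {set vertex};
  vertex_gt0 : 0 < #|vertex|
}.

Definition isolated (H : hypergraph) (v : vertex H) : bool :=
  [forall e : edge H, v \notin inc e].

(* The nat ceil(p|e|); absz loses nothing because the ceiling is nonnegative   *)
(* for 0 <= p.                                                                 *)
Definition threshold (R : realType) (p : R) (H : hypergraph) (e : edge H)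
  : nat := `|Num.ceil (p * #|inc e|%:R)%R|%N.

Definition non_flammable (R : realType) (p : R) (H : hypergraph) (e : edge H)
  : bool := threshold p e == #|inc e|.

Definition flammable (R : realType) (p : R) (H : hypergraph) (e : edge H)
  : bool := ~~ non_flammable p e.

(* Only meaningful when H has an edge; the value is 0 otherwise.               *)
Definition min_threshold (R : realType) (p : R) (H : hypergraph) : nat :=
  if [pick e : edge H] is Some e0
  then threshold p [arg min_(e < e0) threshold p e] else 0.

Definition spread (R : realType) (p : R) (H : hypergraph)
    (F : {set vertex H}) : {set vertex H} :=
  F :|: \bigcup_(e : edge H | threshold p e <= #|inc e :&: F|) inc e.

(* burned p us is F_k for the sources us = (u_1, ..., u_k); propagation and    *)
(* the choice of the source are simultaneous, and round 1 has no propagation.  *)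
Definition burned (R : realType) (p : R) (H : hypergraph)
    (us : seq (vertex H)) : {set vertex H} :=
  if us is u1 :: us'
  then foldl (fun F u => u |: spread p F) [set u1] us' else set0.

Definition legal (R : realType) (p : R) (H : hypergraph)
    (us : seq (vertex H)) : bool :=
  [forall i : 'I_(size us), tnth (in_tuple us) i \notin burned p (take i us)].

Definition burning_sequence (R : realType) (p : R) (H : hypergraph)
    (us : seq (vertex H)) : bool :=
  legal p us && (burned p us == setT).

Lemma burned_rcons (R : realType) (p : R) (H : hypergraph)
    (us : seq (vertex H)) (u : vertex H) :
  burned p us :|: [set u] \subset burned p (rcons us u).
Proof.
case: us => [|u1 us] /=; first by rewrite set0U.
rewrite foldl_rcons setUC; apply: setUS; exact: subsetUl.
Qed.

Lemma legal_rcons (R : realType) (p : R) (H : hypergraph)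
    (us : seq (vertex H)) (u : vertex H) :
  legal p us -> u \notin burned p us -> legal p (rcons us u).
Proof.
move=> /forallP lus uF; apply/forallP => -[i /= lti].
rewrite (tnth_nth u) /= nth_rcons.
move: (lti); rewrite size_rcons ltnS leq_eqVlt => /orP[/eqP ->|ltiu].
  by rewrite ltnn eqxx -cats1 take_size_cat.
rewrite ltiu -cats1 takel_cat 1?ltnW //.
by have := lus (Ordinal ltiu); rewrite (tnth_nth u).
Qed.

Lemma burning_sequence_exists (R : realType) (p : R) (H : hypergraph) :
  exists k, [exists us : k.-tuple (vertex H), burning_sequence p us].
Proof.
suff [us bus] : exists us : seq (vertex H), burning_sequence p us.
  by exists (size us); apply/existsP; exists (in_tuple us).
have : legal p ([::] : seq (vertex H)) by apply/forallP => -[].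
move: [::] => us; have [n] := ubnP #|~: burned p us|.
elim: n us => // n IHn us leF lus.
have [FT|] := eqVneq (burned p us) setT.
  by exists us; rewrite /burning_sequence lus FT eqxx.
rewrite -subTset => /subsetPn[u _ uF].
apply: (IHn (rcons us u)); last exact: legal_rcons.
rewrite ltnS in leF; apply: leq_trans leF; apply: proper_card.
have sub := burned_rcons p us u.
apply/properP; split.
  by rewrite setCS; apply: subset_trans sub; apply: subsetUl.
exists u; rewrite !inE // negbK.
by apply: (subsetP sub); rewrite !inE eqxx orbT.
Qed.

Definition burning_number (R : realType) (p : R) (H : hypergraph) : nat :=
  ex_minn (burning_sequence_exists p H).

Definition lazy_burning_set (R : realType) (p : R) (H : hypergraph)
    (S : {set vertex H}) : Prop :=
  exists n : nat, iter n (spread p (H := H)) S = setT.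

(* The full vertex set is always a lazy burning set, so the minimum is over a  *)
(* nonempty family.                                                            *)
Definition lazy_burning_number (R : realType) (p : R) (H : hypergraph) : nat :=
  #|[arg min_(S < [set: vertex H] | `[< lazy_burning_set p S >]) #|S|]|.

(* Main.v *)
(* Flammability gives [0 < ceil(p|e|) < |e|] for every edge e.

   A set smaller than every threshold does not spread, which is the first
   inequality.

   For the strict inequality, drop the last source u of an optimal burning
   sequence.  All vertices other than u are burned by propagation from the
   remaining sources, so any edge e through u has at least |e| - 1 burned
   vertices, which reaches its threshold; hence u catches fire as well.

   For the upper bound, keep choosing an unburned vertex in an edge that is still
   below its threshold.  Each choice decreases the total deficit
   sum_e (ceil(p|e|) - |e :&: F|), and once the deficit is 0, one more round burns
   every vertex. *)

Require Import Defs.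
From mathcomp Require Import all_boot all_order all_algebra.
From mathcomp Require Import boolp reals.

Set Implicit Arguments.
Unset Strict Implicit.
Unset Printing Implicit Defensive.

Import Order.TTheory GRing.Theory Num.Theory.

(** An empty edge has threshold 0, which equals its size, so it is non-flammable. *)
Lemma flammable_inc_gt0 (R : realType) (p : R) (H : hypergraph) (e : edge H) :
  flammable p e -> 0 < #|inc e|.
Proof.
rewrite lt0n; apply: contra => /eqP e0.
by rewrite /non_flammable /threshold e0 mulr0 ceil0.
Qed.

Lemma flammable_threshold_gt0 (R : realType) (p : R) (H : hypergraph)
    (e : edge H) : (0 < p)%R -> flammable p e -> 0 < threshold p e.
Proof.
move=> p0 /flammable_inc_gt0 e0.
by rewrite /threshold absz_gt0 gt_eqF // ceil_gt0 mulr_gt0 // ltr0n.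
Qed.

Lemma flammable_threshold_lt (R : realType) (p : R) (H : hypergraph)
    (e : edge H) : (0 < p < 1)%R -> flammable p e -> threshold p e < #|inc e|.
Proof.
move=> /andP[p0 p1] fe; rewrite ltn_neqAle; apply/andP; split=> //.
rewrite /threshold -lez_nat gez0_abs.
  by rewrite ceil_le_int /= -pmulrn ler_piMl ?ler0n // ltW.
(* [ceil_ge0] turns nonnegativity of the ceiling into [-1 < p * |e|]. *)
by rewrite ceil_ge0 (lt_le_trans (ltrN10 _)) // mulr_ge0 ?ler0n // ltW.
Qed.

(** The threshold is at most [|e| - 1], and [F] misses at most the vertex [u] of [e]. *)
Lemma flammable_threshold_setD1 (R : realType) (p : R) (H : hypergraph)
    (e : edge H) (F : {set vertex H}) (u : vertex H) :
  (0 < p < 1)%R -> flammable p e -> [set~ u] \subset F ->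
  threshold p e <= #|inc e :&: F|.
Proof.
move=> hp fe uF; rewrite -ltnS.
apply: (leq_trans (flammable_threshold_lt hp fe)).
have eF : inc e :\ u \subset inc e :&: F.
  by rewrite setDE; apply: setIS.
rewrite (cardsD1 u) -addn1 addnC.
by apply: leq_add; [exact: subset_leq_card | exact: leq_b1].
Qed.

Lemma vertex_in_edge (H : hypergraph) (v : vertex H) :
  ~~ isolated v -> exists e : edge H, v \in inc e.
Proof. by rewrite negb_forall => /existsP[e]; rewrite negbK; exists e. Qed.

Lemma min_threshold_le (R : realType) (p : R) (H : hypergraph) (e : edge H) :
  min_threshold p H <= threshold p e.
Proof.
rewrite /min_threshold; case: pickP => [e0 _|/(_ e)//].
by case: arg_minnP => // i _; apply.
Qed.

Lemma sub_spread (R : realType) (p : R) (H : hypergraph)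
    (F : {set vertex H}) : F \subset spread p F.
Proof. exact: subsetUl. Qed.

Lemma inc_sub_spread (R : realType) (p : R) (H : hypergraph)
    (F : {set vertex H}) (e : edge H) :
  threshold p e <= #|inc e :&: F| -> inc e \subset spread p F.
Proof. by move=> he; apply: subsetU; rewrite (bigcup_sup e) ?orbT. Qed.

Lemma spreadS (R : realType) (p : R) (H : hypergraph)
    (F G : {set vertex H}) : F \subset G -> spread p F \subset spread p G.
Proof.
move=> FG; rewrite subUset (subset_trans FG (sub_spread p _)) /=.
apply/bigcupsP => e he; apply: inc_sub_spread; apply: (leq_trans he).
by apply: subset_leq_card; apply: setIS.
Qed.

Lemma iter_spreadS (R : realType) (p : R) (H : hypergraph) (n : nat)
    (F G : {set vertex H}) :
  F \subset G -> iter n (spread p (H := H)) F \subset iter n (spread p (H := H)) G.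
Proof. by move=> FG; elim: n => //= n; apply: spreadS. Qed.

Lemma sub_iter_spread (R : realType) (p : R) (H : hypergraph) (n : nat)
    (F : {set vertex H}) : F \subset iter n (spread p (H := H)) F.
Proof.
by elim: n => //= n /subset_trans; apply; apply: sub_spread.
Qed.

(** The first source is excluded because round 1 has no propagation, whereas [spread p set0] can be
    nonempty, for instance when [p = 0]. *)
Lemma burned_rconsE (R : realType) (p : R) (H : hypergraph)
    (us : seq (vertex H)) (u : vertex H) :
  us != [::] -> burned p (rcons us u) = u |: spread p (burned p us).
Proof. by case: us => // u1 us _ /=; rewrite foldl_rcons. Qed.

(** Comparison of the two games: since [spread] is monotone, lighting all the sources at the start
    burns at least as much as lighting them one per round. *)
Lemma burned_sub_iter_spread (R : realType) (p : R) (H : hypergraph)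
    (us : seq (vertex H)) :
  burned p us \subset iter (size us) (spread p (H := H)) [set:: us].
Proof.
elim/last_ind: us => [|us u IHus]; first exact: sub0set.
have u_us : [set u] \subset [set:: rcons us u].
  by rewrite sub1set inE mem_rcons mem_head.
have [->|us0] := eqVneq us [::].
  apply: subset_trans (sub_iter_spread p _ _).
  by rewrite /= sub1set inE mem_head.
rewrite burned_rconsE // size_rcons subUset.
rewrite (subset_trans u_us (sub_iter_spread p _ _)) /=.
apply/spreadS/(subset_trans IHus)/iter_spreadS.
by apply/subsetP => v; rewrite !inE mem_rcons in_cons => ->; rewrite orbT.
Qed.

Lemma spread_small (R : realType) (p : R) (H : hypergraph)
    (S : {set vertex H}) : #|S| < min_threshold p H -> spread p S = S.
Proof.
move=> Ssmall; rewrite /spread big_pred0 ?setU0 // => e.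
apply/negbTE; rewrite -ltnNge; apply: leq_ltn_trans (_ : #|S| < _).
  exact: subset_leq_card (subsetIr _ _).
exact: leq_trans Ssmall (min_threshold_le p _).
Qed.

Lemma min_threshold_le_lazy_burning_set (R : realType) (p : R) (H : hypergraph)
    (S : {set vertex H}) (e : edge H) :
  (0 < p < 1)%R -> flammable p e -> lazy_burning_set p S ->
  min_threshold p H <= #|S|.
Proof.
move=> hp fe [n Sn]; rewrite leqNgt; apply/negP => Ssmall.
(* Being fixed by [spread], [S] burns everything only if it is the whole vertex set; the edge [e]
   excludes this, as its threshold is below [|e|]. *)
move: Sn; rewrite iter_fix ?spread_small // => ST.
have := leq_trans Ssmall (min_threshold_le p e).
rewrite ltnNge ST => /negP; apply.
apply: leq_trans (ltnW (flammable_threshold_lt hp fe)) _.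
exact: subset_leq_card (subsetT _).
Qed.

Lemma lazy_burning_numberP (R : realType) (p : R) (H : hypergraph) :
  exists2 S : {set vertex H}, lazy_burning_set p S &
    lazy_burning_number p H = #|S|.
Proof.
rewrite /lazy_burning_number; case: arg_minnP; first by apply/asboolP; exists 0.
by move=> S /asboolP hS _; exists S.
Qed.

Lemma lazy_burning_number_le (R : realType) (p : R) (H : hypergraph)
    (S : {set vertex H}) :
  lazy_burning_set p S -> lazy_burning_number p H <= #|S|.
Proof.
move=> hS; rewrite /lazy_burning_number.
case: arg_minnP; first by apply/asboolP; exists 0.
by move=> T _; apply; apply/asboolP.
Qed.

Lemma burning_numberP (R : realType) (p : R) (H : hypergraph) :
  exists2 us : seq (vertex H), burning_sequence p us &
    burning_number p H = size us.
Proof.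
rewrite /burning_number; case: ex_minnP => k /existsP[us hus] _.
by exists us; rewrite ?size_tuple.
Qed.

Lemma burning_number_le (R : realType) (p : R) (H : hypergraph)
    (us : seq (vertex H)) :
  burning_sequence p us -> burning_number p H <= size us.
Proof.
move=> hus; rewrite /burning_number; case: ex_minnP => k _; apply.
by apply/existsP; exists (in_tuple us).
Qed.

Lemma lazy_burning_set_belast (R : realType) (p : R) (H : hypergraph)
    (us : seq (vertex H)) (u : vertex H) :
  (0 < p < 1)%R -> (forall e : edge H, flammable p e) -> ~~ isolated u ->
  burned p (rcons us u) = setT -> lazy_burning_set p [set:: us].
Proof.
move=> hp hflam /vertex_in_edge[e ue] burnedT.
set F := spread p (burned p us).
have uF : [set~ u] \subset F.
  apply/subsetP => v; rewrite !inE => /negbTE vu.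
  have : v \in burned p (rcons us u) by rewrite burnedT inE.
  (* If [u] is the only source, it is the only vertex burned, so no [v] other than [u] exists. *)
  have [us0|us0] := eqVneq us [::]; first by rewrite us0 /= inE vu.
  by rewrite burned_rconsE // !inE vu.
have FT : spread p F = setT.
  apply/eqP; rewrite -subTset -(setUCr [set u]) subUset sub1set.
  rewrite (subset_trans uF (sub_spread p _)) andbT.
  apply: subsetP ue; apply: inc_sub_spread.
  exact: flammable_threshold_setD1 uF.
(* One extra round produces [F], which may miss only [u]; the second one burns [u]. *)
exists (size us).+2; apply/eqP; rewrite -subTset -FT.
by do 2 apply: spreadS; apply: burned_sub_iter_spread.
Qed.

(** Subtraction is truncated, so an edge beyond its threshold counts 0 and cannot offset the lack of
    another edge. *)
Definition deficit (R : realType) (p : R) (H : hypergraph)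
    (F : {set vertex H}) : nat :=
  \sum_(e : edge H) (threshold p e - #|inc e :&: F|).

(** No summand grows, and the one of [e] drops strictly because [e] is still below its threshold in
    [F]. *)
Lemma deficit_lt (R : realType) (p : R) (H : hypergraph)
    (F G : {set vertex H}) (e : edge H) (u : vertex H) :
  F \subset G -> #|inc e :&: F| < threshold p e ->
  u \in inc e -> u \in G -> u \notin F -> deficit p G < deficit p F.
Proof.
move=> FG ltFe ue uG uF; rewrite /deficit (bigD1 e) //= [ltnRHS](bigD1 e) //=.
rewrite -addSn; apply: leq_add; last first.
  by apply: leq_sum => f _; apply/leq_sub2l/subset_leq_card/setIS.
apply: ltn_sub2l => //; apply: proper_card; rewrite properE setIS //=.
by apply/subsetPn; exists u; rewrite !inE ue // uG.
Qed.

Lemma legal_nil (R : realType) (p : R) (H : hypergraph) :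
  legal p ([::] : seq (vertex H)).
Proof. by apply/forallP => -[]. Qed.

(** Starting from an arbitrary legal sequence lets the induction on the deficit go through. The
    extra 1 pays for the final round, in which propagation burns every vertex. *)
Lemma legal_extends (R : realType) (p : R) (H : hypergraph)
    (us : seq (vertex H)) :
  (forall v : vertex H, ~~ isolated v) -> (0 < p < 1)%R ->
  (forall e : edge H, flammable p e) -> legal p us ->
  exists2 vs : seq (vertex H), burning_sequence p vs &
    size vs <= size us + (deficit p (burned p us)).+1.
Proof.
move=> hiso hp hflam; have [p0 _] := andP hp.
have [n] := ubnP (deficit p (burned p us)).
elim: n us => // n IHn us; rewrite ltnS => len lus.
have [/existsP[e ltFe]|] :=
  boolP [exists e : edge H, #|inc e :&: burned p us| < threshold p e].
  (* A fully burned edge would have reached its threshold. *)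
  have /subsetPn[u ue uF] : ~~ (inc e \subset burned p us).
    apply: contraL ltFe => /setIidPl ->.
    by rewrite -leqNgt ltnW // flammable_threshold_lt.
  have /subUsetP[sub usub] := burned_rcons p us u.
  have uG : u \in burned p (rcons us u) by rewrite -sub1set.
  have lt := deficit_lt sub ltFe ue uG uF.
  have [|vs bvs vsle] := IHn (rcons us u) (leq_trans lt len).
    exact: legal_rcons.
  exists vs => //; apply: (leq_trans vsle).
  by rewrite size_rcons addSnnS leq_add2l ltnS.
rewrite negb_exists => /forallP satisfied.
(* With no source, an edge through [v] would be below its positive threshold. Hence the next round
   does propagate. *)
have us0 : us != [::].
  apply/eqP => us0; have /card_gt0P[v _] := vertex_gt0 H.
  have [e _] := vertex_in_edge (hiso v).
  by have := satisfied e; rewrite us0 setI0 cards0 flammable_threshold_gt0.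
have [FT|] := eqVneq (burned p us) setT.
  by exists us; rewrite ?leq_addr // /burning_sequence lus FT eqxx.
rewrite -subTset => /subsetPn[u _ uF].
(* The final round still needs a legal source; any unburned [u] will do. *)
exists (rcons us u); last by rewrite size_rcons addnS ltnS leq_addr.
rewrite /burning_sequence legal_rcons //= -subTset burned_rconsE //.
apply/subsetP => v _; have [e ve] := vertex_in_edge (hiso v).
rewrite inE; apply/orP; right; apply: subsetP ve; apply: inc_sub_spread.
by rewrite leqNgt.
Qed.

Theorem theorem2p20 (R : realType) (H : hypergraph) (p : R)
  (hiso : forall v : vertex H, ~~ isolated v)
  (hp : (0 < p < 1)%R)
  (hflam : forall e : edge H, flammable p e) :
  [/\ min_threshold p H <= lazy_burning_number p H,
      lazy_burning_number p H < burning_number p H &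
      burning_number p H <= 1 + \sum_(e : edge H) threshold p e].
Proof.
have /card_gt0P[v _] := vertex_gt0 H.
have [e _] := vertex_in_edge (hiso v).
split.
- have [S hS ->] := lazy_burning_numberP p H.
  exact: min_threshold_le_lazy_burning_set (hflam e) hS.
- have [us /andP[_ /eqP]] := burning_numberP p H.
  (* The empty sequence does not burn [v], so there is a last source to drop. *)
  case/lastP: us => [/setP/(_ v)|us u usT ->]; first by rewrite !inE.
  rewrite size_rcons ltnS; apply: leq_trans (card_size us).
  rewrite -cardsE; apply: lazy_burning_number_le.
  exact: lazy_burning_set_belast (hiso u) usT.
- have [vs bvs vsle] := legal_extends hiso hp hflam (legal_nil p H).
  apply: leq_trans (burning_number_le bvs) _; apply: (leq_trans vsle).
  rewrite add0n add1n ltnS; apply: leq_sum => f _; exact: leq_subr.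
Qed.
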